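(* Let $G$ be a 2-connected, linear-convex supergrid graph. Then $G$ is cycle extendable: $G$ contains at least one cycle, and for every cycle $C$ of $G$ that is not Hamiltonian there is a cycle $C'$ of $G$ with $V(C)\subset V(C')$ and $|V(C')|=|V(C)|+1$.
   Context: The two-dimensional supergrid $S^\infty$ is the infinite graph whose vertex set is $\mathbb{Z}^2$, in which two distinct vertices $(a,b)$ and $(c,d)$ are adjacent if and only if $|a-c|\le 1$ and $|b-d|\le 1$. A supergrid graph is a finite vertex-induced subgraph of $S^\infty$. A supergrid graph $G$ is linear-convex if for every line $l$ in the plane that contains an edge of $S^\infty$ (every horizontal, vertical, slope $+1$ or slope $-1$ line through integer points), the intersection of $l$ with $G$ is either empty, a single vertex, or a line segment forming a path of $G$; equivalently, the vertices of $G$ on $l$ form a (possibly empty) set of consecutive lattice points of $l$. A graph is 2-connected if there are two internally vertex-disjoint paths between every pair of its vertices (with the standard convention that it has at least three vertices). A cycle is Hamiltonian if it visits every vertex of $G$. *)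

(* Defs.v *)
From mathcomp Require Import all_boot all_order all_algebra.
From mathcomp Require Import finmap.

Set Implicit Arguments.
Unset Strict Implicit.
Unset Printing Implicit Defensive.

Import Order.TTheory GRing.Theory Num.Theory.
Local Open Scope ring_scope.

Notation point := (int * int)%type.

Definition supergrid_adj : rel point :=
  [rel p q | [&& p != q, `|p.1 - q.1| <= 1 & `|p.2 - q.2| <= 1]].

(* A supergrid graph is given by its vertex set; the coercion of a finite set
   to the finite type of its elements is the vertex type. *)
Definition supergrid_rel (G : {fset point}) : rel G :=
  [rel u v | supergrid_adj (val u) (val v)].

Arguments supergrid_rel G : clear implicits.

(* [v] lies on the line through [p] and [q], for [p != q]. *)
Definition on_line (p q v : point) : bool :=
  (v.1 - p.1) * (q.2 - p.2) == (v.2 - p.2) * (q.1 - p.1).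

(* The lines containing an edge are the lines through two adjacent points [p]
   and [q]; consecutive lattice points on such a line differ by [q - p].  The
   value [n = 0] is the case of a single vertex. *)
Definition linear_convex (G : {fset point}) : Prop :=
  forall p q : point, supergrid_adj p q ->
    (forall v, v \in G -> ~~ on_line p q v) \/
    (exists (a : point) (n : nat), forall v : point,
       ((v \in G) && on_line p q v) <->
       exists2 k : nat, (k <= n)%N & v = a + (q - p) *+ k).

Section Graph.

Variables (T : finType) (e : rel T).

(* [s] is the sequence of internal vertices of a path from [u] to [v]. *)
Definition internal_path (u v : T) (s : seq T) : bool :=
  path e u (rcons s v) && uniq (u :: rcons s v).

(* The condition [s1 != s2] excludes using an edge [uv] twice. *)
Definition two_connected : Prop :=
  (2 < #|T|)%N /\
  forall u v : T, u != v ->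
    exists s1 s2 : seq T,
      [/\ internal_path u v s1, internal_path u v s2, s1 != s2
        & [disjoint s1 & s2]].

Definition graph_cycle (c : seq T) : bool :=
  [&& (2 < size c)%N, cycle e c & uniq c].

Definition hamiltonian (c : seq T) : Prop := forall x : T, x \in c.

Definition cycle_extendable : Prop :=
  (exists c : seq T, graph_cycle c) /\
  forall c : seq T, graph_cycle c -> ~ hamiltonian c ->
    exists c' : seq T,
      [/\ graph_cycle c', c \subset c' & #|c'| = #|c|.+1].

End Graph.

(* Main.v *)
(* Suppose that a cycle C is not extensible and that y is off C and u on C.
   Writing x- and x+ for the neighbours of x along C, a longer cycle is avoided
   only if y is adjacent to no two consecutive vertices of C, if u+ and w+ are
   not adjacent whenever y is adjacent to u and w, and if, when moreover u- and
   u+ are adjacent, u is not adjacent to w+ (nor to w-, reversing C).  In the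
   king's graph this excludes in turn that y and u be adjacent in the following
   positions, up to symmetry.
   - u = (0,0), y = (0,1) and w = (1,0) on C: the few possible places for u-, u+,
     w-, w+ lead by convexity to a vertex at (1,1), which has no place on C.
   - u = (0,0), y = (1,0): a vertex at (0,1) or (0,-1) is excluded, by the previous
     case when it is on C and by lack of room for both u- and u+ otherwise; by
     convexity u is then alone in its column, which separates u+ from y.
   - u = (0,0), y = (1,1): by the previous case neither (1,0) nor (0,1) is a
     vertex, and u separates the open quadrant of y from u+.
   Since the graph is connected, C is Hamiltonian. *)
Require Import Defs.
From mathcomp Require Import all_boot all_order all_algebra.
From mathcomp Require Import finmap.
From mathcomp Require Import zify.

Set Implicit Arguments.
Unset Strict Implicit.
Unset Printing Implicit Defensive.

Import Order.TTheory GRing.Theory Num.Theory.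

(** * Cycles that cannot be extended by one vertex *)

Section CycleExtension.

Variables (T : finType) (e : rel T).
Hypothesis e_sym : symmetric e.

(** Fixing the length in the type makes the quantifier range over a finite type, so that the
    predicate is boolean. *)
Definition extensible (c : seq T) : bool :=
  [exists c' : (size c).+1.-tuple T, graph_cycle e c' && (c \subset c')].

Lemma extensibleP (c : seq T) :
  reflect (exists c' : seq T,
    [/\ graph_cycle e c', c \subset c' & size c' = (size c).+1]) (extensible c).
Proof.
apply: (iffP existsP) => [[c' /andP[gc' sub]]|[c' [gc' sub sz]]].
  by exists c'; rewrite size_tuple.
by exists (Tuple (introT eqP sz)); rewrite gc'.
Qed.

Lemma extensible_perm (c1 c2 : seq T) :
  perm_eq c1 c2 -> extensible c1 = extensible c2.
Proof.
move=> eqc; have eqm := perm_mem eqc.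
have sub c' : (c1 \subset c') = (c2 \subset c') by exact: eq_subset.
by apply/extensibleP/extensibleP => -[c' H]; exists c'; move: H;
  rewrite (perm_size eqc) sub.
Qed.

Lemma perm_extensible (c c' : seq T) (y : T) :
  graph_cycle e c -> y \notin c -> perm_eq c' (y :: c) -> cycle e c' ->
  extensible c.
Proof.
move=> /and3P[sz _ uc] yc eqc cyc; apply/extensibleP; exists c'.
rewrite /graph_cycle cyc (perm_size eqc) (perm_uniq eqc) /= yc uc ltnW //.
by split=> //; apply/subsetP => x xc; rewrite (perm_mem eqc) inE xc orbT.
Qed.

Lemma graph_cycle_rot (k : nat) (c : seq T) :
  graph_cycle e (rot k c) = graph_cycle e c.
Proof. by rewrite /graph_cycle size_rot rot_cycle rot_uniq. Qed.

Lemma graph_cycle_rev (c : seq T) : graph_cycle e (rev c) = graph_cycle e c.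
Proof.
rewrite /graph_cycle size_rev rev_uniq rev_cycle.
by rewrite (eq_cycle (e' := e)) // => x y; rewrite e_sym.
Qed.

(** Every Hamiltonian cycle is of this kind; the goal is the converse, [stuck_hamiltonian]. *)
Definition stuck (c : seq T) : bool := graph_cycle e c && ~~ extensible c.

Lemma stuck_rot (k : nat) (c : seq T) : stuck (rot k c) = stuck c.
Proof.
by rewrite /stuck graph_cycle_rot (extensible_perm (c2 := c)) // perm_rot.
Qed.

(** Reversal exchanges successor and predecessor, so facts about [prev] follow from those about
    [next]. *)
Lemma stuck_rev (c : seq T) : stuck (rev c) = stuck c.
Proof.
by rewrite /stuck graph_cycle_rev (extensible_perm (c2 := c)) // perm_rev.
Qed.

Lemma stuckN (c c' : seq T) (y : T) :
  stuck c -> y \notin c -> perm_eq c' (y :: c) -> ~ cycle e c'.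
Proof.
by move=> /andP[gc /negP ext] yc eqc /(perm_extensible gc yc eqc).
Qed.

(** * Exchanges around successors and predecessors on a cycle *)

Lemma next_cat (s1 s2 : seq T) (x : T) :
  uniq (s1 ++ x :: s2) -> next (s1 ++ x :: s2) x = head x (s2 ++ s1).
Proof.
move=> us; rewrite -(next_rot (size s1)) // rot_size_cat /=.
by case: (s2 ++ s1) => [|a s] /=; rewrite eqxx.
Qed.

Lemma prev_cat (s1 s2 : seq T) (x : T) :
  uniq (s1 ++ x :: s2) -> prev (s1 ++ x :: s2) x = last x (s2 ++ s1).
Proof.
move=> us; rewrite -next_rev // rev_cat rev_cons cat_rcons next_cat.
  by rewrite -rev_cat; case/lastP: (s2 ++ s1) => // s z; rewrite rev_rcons last_rcons.
by rewrite -cat_rcons -rev_cons -rev_cat rev_uniq.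
Qed.

(** Otherwise [y] could be inserted between [u] and its successor. *)
Lemma stuck_next (c : seq T) (u y : T) :
  stuck c -> u \in c -> y \notin c -> e y u -> ~~ e y (next c u).
Proof.
move=> sc uc; case/splitPr: uc sc => s1 s2 sc.
move: (sc) => /andP[/and3P[sz cyc uc] _] yc yu.
rewrite next_cat //; apply/negP=> ya.
apply: (@stuckN _ (u :: y :: s2 ++ s1) _ sc yc).
  rewrite -[_ :: _]/([:: u] ++ [:: y] ++ s2 ++ s1) perm_catCA /= perm_cons.
  by rewrite -cat_cons perm_catC.
move: cyc sz; rewrite -(rot_cycle (size s1)) rot_size_cat size_cat addnC /=.
rewrite addSn -size_cat; case: (s2 ++ s1) ya => [|a s] //= ya /andP[_ ->] _.
by rewrite e_sym yu ya.
Qed.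

Lemma rot_split (c : seq T) (u w : T) : u \in c -> w \in c -> u != w ->
  exists k s1 s2, rot k c = u :: s1 ++ w :: s2.
Proof.
move=> uc wc uw; have [k s Ec] := rot_to uc.
move: wc; rewrite -(mem_rot k) Ec inE eq_sym (negPf uw) /= => ws.
by case/splitPr: ws Ec => s1 s2 Ec; exists k, s1, s2.
Qed.

(* Otherwise [u y w .. u+ w+ .. u], which runs from [w] back to [u+], is a
   longer cycle. *)
Lemma stuck_next2 (c : seq T) (u w y : T) :
  stuck c -> u \in c -> w \in c -> u != w -> y \notin c ->
  e y u -> e y w -> ~~ e (next c u) (next c w).
Proof.
move=> sc uc wc uw yc yu yw; have /andP[/and3P[_ _ Uc] _] := sc.
have:= stuck_next sc uc yc yu; have:= stuck_next sc wc yc yw.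
have [k [s1 [s2 Ec]]] := rot_split uc wc uw.
rewrite -(next_rot k Uc u) -(next_rot k Uc w); rewrite -(mem_rot k) in yc.
rewrite -(stuck_rot k) in sc; rewrite -(rot_uniq k) in Uc.
rewrite {}Ec in sc Uc yc *.
rewrite (@next_cat [::] _ u Uc) cats0 (@next_cat (u :: s1) s2 w Uc).
have /andP[/and3P[_ cyc _] _] := sc.
(* If [s1] is empty, [w] is the successor of [u], and [stuck_next] forbids [y] to be adjacent to
   it. *)
case: s1 sc yc cyc {Uc} => [|a t] sc yc cyc /=; first by rewrite yw.
move=> _ _; apply/negP=> aw.
apply: (@stuckN _ (u :: y :: w :: rev (a :: t) ++ s2) _ sc yc).
  rewrite -[u :: _]/([:: u] ++ [:: y] ++ _) perm_catCA /= !perm_cons.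
  by rewrite -[w :: _]/([:: w] ++ _) perm_catCA /= -cat_cons perm_cat // perm_rev.
move: cyc aw; rewrite /= !rcons_cat /= !cat_path /= => /and4P[ua pt tw ps] aw.
rewrite e_sym yu yw /=.
have -> : path e w (rev (a :: t)).
  have := rev_path e a (rcons t w); rewrite last_rcons belast_rcons => ->.
  rewrite (eq_path (e' := e)) => [|x z]; last by rewrite e_sym.
  by rewrite rcons_path pt.
rewrite rev_cons last_rcons.
by case: s2 {sc yc} ps aw => [|h s2] /= /andP[_ ph] ->.
Qed.

(* Otherwise [u] can be bypassed and [y u] inserted between [w] and [w+]. *)
Lemma stuck_bypass_next (c : seq T) (u w y : T) :
  stuck c -> u \in c -> w \in c -> u != w -> y \notin c ->
  e y u -> e y w -> e (prev c u) (next c u) -> ~~ e u (next c w).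
Proof.
move=> sc uc wc uw yc yu yw; have /andP[/and3P[_ _ Uc] _] := sc.
have:= stuck_next sc uc yc yu; have:= stuck_next sc wc yc yw.
have [|k [s1 [s2 Ec]]] := rot_split wc uc; first by rewrite eq_sym.
rewrite -(prev_rot k Uc) -(next_rot k Uc u) -(next_rot k Uc w); rewrite -(mem_rot k) in yc.
rewrite -(stuck_rot k) in sc; rewrite -(rot_uniq k) in Uc.
rewrite {}Ec in sc Uc yc *.
rewrite (@next_cat [::] _ w Uc) cats0 (@next_cat (w :: s1) s2 u Uc).
rewrite (@prev_cat (w :: s1) s2 u Uc) last_cat /=.
have /andP[/and3P[_ cyc _] _] := sc.
case: s1 sc yc cyc {Uc} => [|a t] sc yc cyc /=; first by rewrite yu.
move=> _ _ pn; apply/negP=> ua.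
apply: (@stuckN _ (w :: y :: u :: a :: t ++ s2) _ sc yc).
  rewrite -[w :: _]/([:: w] ++ [:: y] ++ _) perm_catCA /= !perm_cons.
  by rewrite -[u :: _]/([:: u] ++ (a :: t) ++ s2) perm_catCA.
move: cyc pn; rewrite /= !rcons_cat /= !cat_path /= => /and4P[_ pt _ ps] pn.
rewrite e_sym yu yw ua pt /=.
by case: s2 {sc yc} ps pn => [|h s2] /= /andP[_ ph] ->.
Qed.

(** A cycle has at least three vertices, so those other than [u], listed from the successor of [u]
    on, have distinct first and last elements. *)
Lemma next_neq_prev (c : seq T) (u : T) :
  graph_cycle e c -> u \in c -> next c u != prev c u.
Proof.
move=> /and3P[sz _ Uc] uc; case/splitPr: uc sz Uc => s1 s2.
rewrite size_cat addnC /= addSn -size_cat => sz Uc; rewrite next_cat // prev_cat //.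
move: Uc; rewrite -(rot_uniq (size s1)) rot_size_cat /= => /andP[_].
move: sz; case: (s2 ++ s1) => [|a [|b s]] //= _ /andP[+ _].
by apply: contra => /eqP->; apply: mem_last.
Qed.

(** * Integer coordinates in the king's graph *)

Local Open Scope ring_scope.

(** An embedding in the king's graph with convex rows and columns. Keeping [X] and [Y] abstract
    gives access to all symmetries of the square, which [king_swap] and [king_opp] generate. *)
Record king_coordinates (X Y : T -> int) : Prop := KingCoordinates {
  king_adjE : forall a b, e a b =
    [&& a != b, X a - X b <= 1, X b - X a <= 1, Y a - Y b <= 1 & Y b - Y a <= 1];
  king_inj : forall a b, X a = X b -> Y a = Y b -> a = b;
  king_row : forall a b k, Y a = Y b -> X a <= k -> k <= X b ->
    exists2 c, X c = k & Y c = Y a;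
  king_col : forall a b k, X a = X b -> Y a <= k -> k <= Y b ->
    exists2 c, Y c = k & X c = X a
}.

Lemma king_swap (X Y : T -> int) : king_coordinates X Y -> king_coordinates Y X.
Proof.
case=> adj inj row col; split=> // [a b|a b Yab Xab]; last exact: inj.
by rewrite adj; congr (_ && _); apply/idP/idP; lia.
Qed.

Lemma king_opp (X Y : T -> int) :
  king_coordinates X Y -> king_coordinates (fun a => - X a) Y.
Proof.
case=> adj inj row col; split=> [a b|a b Xab Yab|a b k Yab Xa Xb|a b k Xab Ya Yb].
- by rewrite adj; congr (_ && _); apply/idP/idP; lia.
- by apply: inj => //; lia.
- by have [| | |c Xc Yc] := row b a (- k); try lia; exists c; lia.
- by have [| | |c Yc Xc] := col a b k; try lia; exists c; lia.
Qed.

(** * Adjacency as linear inequalities *)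

Section King.

Variables X Y : T -> int.
Hypothesis kXY : king_coordinates X Y.

Lemma king_near (a b : T) : e a b ->
  [/\ X a - X b <= 1, X b - X a <= 1, Y a - Y b <= 1, Y b - Y a <= 1
    & X a != X b \/ Y a != Y b].
Proof.
rewrite (king_adjE kXY) => /and5P[ab -> -> -> ->]; split=> //.
case: (eqVneq (X a) (X b)) => [Xab|]; last by left.
by right; apply: contra ab => /eqP Yab; apply/eqP/(king_inj kXY).
Qed.

Lemma king_far (a b : T) : a != b -> ~~ e a b ->
  [\/ 1 < X a - X b, 1 < X b - X a, 1 < Y a - Y b | 1 < Y b - Y a].
Proof.
by move=> ab; rewrite (king_adjE kXY) ab /= !negb_and -!ltNge => /or4P.
Qed.

Lemma king_adjP (a b : T) : X a != X b \/ Y a != Y b ->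
  X a - X b <= 1 -> X b - X a <= 1 -> Y a - Y b <= 1 -> Y b - Y a <= 1 -> e a b.
Proof.
move=> ab X1 X2 Y1 Y2; rewrite (king_adjE kXY) X1 X2 Y1 Y2 !andbT.
by apply/eqP=> Eab; move: ab; rewrite Eab !eqxx; case.
Qed.

Lemma king_neq (a b : T) : a != b -> X a != X b \/ Y a != Y b.
Proof.
move=> ab; case: (eqVneq (X a) (X b)) => [Xab|]; last by left.
by right; apply: contra ab => /eqP Yab; apply/eqP/(king_inj kXY).
Qed.

End King.

(** * Inequalities around a stuck cycle *)

Section Stuck.

Variables (c : seq T) (y : T).
Hypotheses (sc : stuck c) (yc : y \notin c).

Let Uc : uniq c. Proof. by case/andP: sc => /and3P[]. Qed.

Lemma stuck_next_far (X Y : T -> int) (u : T) : king_coordinates X Y ->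
  u \in c -> e y u ->
  [\/ 1 < X y - X (next c u), 1 < X (next c u) - X y,
      1 < Y y - Y (next c u) | 1 < Y (next c u) - Y y].
Proof.
move=> kXY uc yu; apply: (king_far kXY); last exact: stuck_next.
by apply: contraNneq yc => ->; rewrite mem_next.
Qed.

Lemma stuck_next2_far (X Y : T -> int) (u w : T) : king_coordinates X Y ->
  u \in c -> w \in c -> u != w -> e y u -> e y w ->
  [\/ 1 < X (next c u) - X (next c w), 1 < X (next c w) - X (next c u),
      1 < Y (next c u) - Y (next c w) | 1 < Y (next c w) - Y (next c u)].
Proof.
move=> kXY uc wc uw yu yw; apply: (king_far kXY).
  by apply: contra uw => /eqP/(can_inj (prev_next Uc))->.
exact: (@stuck_next2 _ _ _ y).
Qed.

Lemma stuck_bypass_next_far (X Y : T -> int) (u w : T) : king_coordinates X Y ->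
  u \in c -> w \in c -> u != w -> e y u -> e y w ->
  e (prev c u) (next c u) ->
  [\/ 1 < X u - X (next c w), 1 < X (next c w) - X u,
      1 < Y u - Y (next c w) | 1 < Y (next c w) - Y u].
Proof.
move=> kXY uc wc uw yu yw pn; apply: (king_far kXY).
  by apply: contraTneq yu => ->; apply: stuck_next.
exact: (@stuck_bypass_next _ _ _ y).
Qed.

End Stuck.

(** * An off-cycle vertex adjacent to a horizontal or vertical pair of cycle vertices *)

Lemma stuck_next_edge (c : seq T) (u : T) :
  stuck c -> u \in c -> e u (next c u).
Proof. by case/andP=> /and3P[_ + _] _; apply: next_cycle. Qed.

(** Put [u] at (0,0), and suppose the successor of [w] is at (2,1). By convexity there is a vertex
    [z] at (1,1); it is on [c], or it could be inserted after [w]. Its successor is far from [y],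
    hence in column 2, and so equal or adjacent to that of [w], against [stuck_next2_far]. *)
Lemma stuck_corner (c : seq T) (y : T) (X Y : T -> int) (u w : T) :
  stuck c -> y \notin c -> king_coordinates X Y -> u \in c -> w \in c ->
  X y = X u -> Y y = Y u + 1 -> X w = X u + 1 -> Y w = Y u ->
  ~ (X (next c w) = X w + 1 /\ Y (next c w) = Y w + 1).
Proof.
move=> sc yc kXY uc wc Xy Yy Xw Yw [Xn Yn].
have [|||z Xz Yz] := king_row kXY (a := y) (b := next c w) (k := X w);
  [clear -Yy Yw Yn; lia|clear -Xy Xw; lia|clear -Xn; lia|].
have yw : e y w by apply: (king_adjP kXY); clear -Xy Yy Xw Yw; lia.
have yz : e y z by apply: (king_adjP kXY); clear -Xy Yy Xw Yw Xz Yz; lia.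
have wz : e z w by apply: (king_adjP kXY); clear -Xy Yy Xw Yw Xz Yz; lia.
have zn : e z (next c w).
  by apply: (king_adjP kXY); clear -Xy Yy Xw Yw Xz Yz Xn Yn; lia.
have zc : z \in c.
  by apply/negPn/negP=> zc; have /negP := stuck_next sc wc zc wz.
have zw : z != w.
  by apply/eqP=> zw; move: Yz; rewrite zw; clear -Yy Yw; lia.
have far := stuck_next_far sc yc kXY zc yz.
have [n1 n2 n3 n4 _] := king_near kXY (stuck_next_edge sc zc).
have Xnz : X (next c z) = X z + 1.
  by case: far; clear -Xy Yy Xw Yw Xz Yz n1 n2 n3 n4; lia.
by case: (stuck_next2_far sc yc kXY zc wc zw yz yw);
  clear -Xnz Xz Yz Yy Yw n3 n4 Xn Yn; lia.
Qed.

Lemma stuck_orthogonal_base (c : seq T) (y : T) (X Y : T -> int) (u w : T) :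
  stuck c -> y \notin c -> king_coordinates X Y -> u \in c -> w \in c ->
  X y = X u -> Y y = Y u + 1 -> X w = X u + 1 -> Y w = Y u -> False.
Proof.
move=> sc yc kXY uc wc Xy Yy Xw Yw.
have Uc : uniq c by case/andP: sc => /and3P[].
have yw : e y w by apply: (king_adjP kXY); clear -Xy Yy Xw Yw; lia.
have yu : e y u by apply: (king_adjP kXY); clear -Xy Yy Xw Yw; lia.
have uw : u != w by apply/eqP=> uw; move: Xw; rewrite uw; clear; lia.
have wu : w != u by rewrite eq_sym.
have gc : graph_cycle e c by case/andP: sc.
have sc' : stuck (rev c) by rewrite stuck_rev.
have [yc' uc' wc'] : [/\ y \notin rev c, u \in rev c & w \in rev c].
  by rewrite !mem_rev.
have prevE : prev c =1 next (rev c) by move=> x; rewrite next_rev.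
have nextE : next c =1 prev (rev c) by move=> x; rewrite -next_rev ?rev_uniq // revK.
have cn := stuck_corner sc yc kXY uc wc Xy Yy Xw Yw.
have cp := stuck_corner sc' yc' kXY uc' wc' Xy Yy Xw Yw.
have fnw := stuck_next_far sc yc kXY wc yw.
have fpw := stuck_next_far sc' yc' kXY wc' yw.
have fn := stuck_next2_far sc yc kXY uc wc uw yu yw.
have fp := stuck_next2_far sc' yc' kXY uc' wc' uw yu yw.
have [nw1 nw2 nw3 nw4 _] := king_near kXY (stuck_next_edge sc wc).
have [pw1 pw2 pw3 pw4 _] := king_near kXY (stuck_next_edge sc' wc').
(* Put [u] at (0,0), [y] at (0,1), [w] at (1,0). Being far from [y], both neighbours of [u] along
   [c] lie in row -1. *)
have [Ynu nu1 nu2] :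
    [/\ Y (next c u) = Y u - 1, X u - X (next c u) <= 1 & X (next c u) - X u <= 1].
  have [-> -> m3 m4 _] := king_near kXY (stuck_next_edge sc uc); split=> //.
  have [m1 m2 _ _ _] := king_near kXY (stuck_next_edge sc uc).
  by case: (stuck_next_far sc yc kXY uc yu); clear -Xy Yy m1 m2 m3 m4; lia.
have [Ypu pu1 pu2] : [/\ Y (next (rev c) u) = Y u - 1,
    X u - X (next (rev c) u) <= 1 & X (next (rev c) u) - X u <= 1].
  have [-> -> m3 m4 _] := king_near kXY (stuck_next_edge sc' uc'); split=> //.
  have [m1 m2 _ _ _] := king_near kXY (stuck_next_edge sc' uc').
  by case: (stuck_next_far sc' yc' kXY uc' yu); clear -Xy Yy m1 m2 m3 m4; lia.
have npu : X (next c u) != X (next (rev c) u).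
  have := king_neq kXY (next_neq_prev gc uc); rewrite prevE Ynu Ypu.
  by case=> // /eqP.
have npw := king_neq kXY (next_neq_prev gc wc); rewrite prevE in npw.
(* If they are not adjacent, one of them is at (1,-1), which pushes the corresponding neighbour of
   [w] to the excluded corner (2,1). *)
case pn : (e (prev c u) (next c u)); last first.
  have : prev c u != next c u by rewrite eq_sym next_neq_prev.
  move/(king_far kXY)/(_ (negbT pn)); rewrite prevE => far.
  have [X1|X1] : X (next c u) = X u + 1 \/ X (next (rev c) u) = X u + 1.
  - by case: far; clear -Ynu Ypu nu1 nu2 pu1 pu2; lia.
  - apply: cn; clear -Xy Yy Xw Yw nw1 nw2 nw3 nw4 fnw fn X1 Ynu.
    by case: fnw => ?; case: fn => ?; lia.
  - apply: cp; clear -Xy Yy Xw Yw pw1 pw2 pw3 pw4 fpw fp X1 Ypu.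
    by case: fpw => ?; case: fp => ?; lia.
(* Now [u] can be bypassed. This forces both neighbours of [w] into column 2; without the corner,
   only (2,0) and (2,-1) remain, which are adjacent. *)
have bn := stuck_bypass_next_far sc yc kXY uc wc uw yu yw pn.
have pn' : e (prev (rev c) u) (next (rev c) u) by rewrite -prevE -nextE e_sym.
have bp := stuck_bypass_next_far sc' yc' kXY uc' wc' uw yu yw pn'.
have Xnw : X (next c w) = X w + 1.
  by clear -Xy Yy Xw Yw nw1 nw2 nw3 nw4 fnw bn; case: bn; case: fnw; lia.
have Xpw : X (next (rev c) w) = X w + 1.
  by clear -Xy Yy Xw Yw pw1 pw2 pw3 pw4 fpw bp; case: bp; case: fpw; lia.
have Ynw : Y (next c w) != Y w + 1 by apply/eqP=> Ynw; case: cn.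
have Ypw : Y (next (rev c) w) != Y w + 1 by apply/eqP=> Ypw; case: cp.
have qn : e (prev c w) (next c w).
  rewrite prevE; apply: (king_adjP kXY);
  clear -Xnw Xpw Ynw Ypw nw3 nw4 pw3 pw4 npw; [|lia..].
  by case: npw; lia.
have qn' : e (prev (rev c) w) (next (rev c) w) by rewrite -prevE -nextE e_sym.
(* So [w] can be bypassed in turn, which forces both neighbours of [u] to the same point (-1,-1). *)
have := stuck_bypass_next_far sc yc kXY wc uc wu yw yu qn.
have := stuck_bypass_next_far sc' yc' kXY wc' uc' wu yw yu qn'.
clear -Xw Yw Ynu nu1 nu2 Ypu pu1 pu2 npu.
by case=> ?; case=> ?; lia.
Qed.

(** Since [y] is adjacent to both [u] and [w], it is directly above one of them. *)
Lemma stuck_orthogonal_row (c : seq T) (y : T) (X Y : T -> int) (u w : T) :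
  stuck c -> y \notin c -> king_coordinates X Y -> u \in c -> w \in c ->
  Y y = Y u + 1 -> Y w = Y u -> e u w -> e y u -> e y w -> False.
Proof.
move=> sc yc kXY uc wc Yy Yw uw yu yw.
have [u1 u2 _ _ u3] := king_near kXY uw.
have [y1 y2 _ _ _] := king_near kXY yu.
have [w1 w2 _ _ _] := king_near kXY yw.
have [Xy|Xy] : X y = X u \/ X y = X w.
- by clear -u1 u2 u3 y1 y2 w1 w2 Yw; lia.
- have [Xw|Xw] : X w = X u + 1 \/ - X w = - X u + 1.
  + by clear -u1 u2 u3 Yw; lia.
  + exact: (stuck_orthogonal_base sc yc kXY uc wc).
  + apply: (stuck_orthogonal_base sc yc (king_opp kXY) uc wc) => //.
    by rewrite Xy.
- have [Xw|Xw] : X u = X w + 1 \/ - X u = - X w + 1.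
  + by clear -u1 u2 u3 Yw; lia.
  + by apply: (stuck_orthogonal_base sc yc kXY wc uc) => //; rewrite Yw.
  + by apply: (stuck_orthogonal_base sc yc (king_opp kXY) wc uc); rewrite ?Yw ?Xy.
Qed.

Lemma stuck_orthogonal (c : seq T) (y : T) (X Y : T -> int) (u w : T) :
  stuck c -> y \notin c -> king_coordinates X Y -> u \in c -> w \in c ->
  Y w = Y u -> Y y != Y u -> e u w -> e y u -> e y w -> False.
Proof.
move=> sc yc kXY uc wc Yw Yyu uw yu yw.
have [_ _ y1 y2 _] := king_near kXY yu.
have [Yy|Yy] : Y y = Y u + 1 \/ - Y y = - Y u + 1 by clear -y1 y2 Yyu; lia.
  exact: (stuck_orthogonal_row sc yc kXY uc wc).
(* Conjugated by the swap, [king_opp] negates the second coordinate. *)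
apply: (stuck_orthogonal_row sc yc (king_swap (king_opp (king_swap kXY))) uc wc) => //.
by rewrite Yw.
Qed.

(** * Separation arguments in the absence of cut vertices *)

Hypothesis connectedD1 : forall u a b, a != u -> b != u ->
  exists p, [/\ path e a p, last a p = b & u \notin a :: p].

(** A discrete intermediate value theorem along a path avoiding [u]: rising by at most 1 per edge,
    [f] cannot jump over 0. *)
Lemma crossing (f : T -> int) (u a b : T) :
  (forall v w, e v w -> f w - f v <= 1) -> a != u -> b != u ->
  f a <= 0 -> 0 <= f b -> exists2 v, v != u & f v = 0.
Proof.
move=> f_lip au bu fa fb; have [p [pp lp up]] := connectedD1 au bu.
elim: p a {au} fa pp lp up => [|w p IHp] a fa /=.
  move=> _ ab; rewrite inE => ua; exists a; first by rewrite eq_sym.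
  by apply/eqP; rewrite eq_le fa ab.
move=> /andP[/f_lip faw pw] lp; rewrite inE negb_or => /andP[ua up].
have [fa0|fa0] := eqVneq (f a) 0; first by exists a; rewrite // eq_sym.
by apply: (IHp w) => //; clear -fa fa0 faw; lia.
Qed.

Lemma stuck_row_base (c : seq T) (y : T) (X Y : T -> int) (u : T) :
  stuck c -> y \notin c -> king_coordinates X Y -> u \in c ->
  Y y = Y u -> X y = X u + 1 -> False.
Proof.
move=> sc yc kXY uc Yy Xy.
have yu : e y u by apply: (king_adjP kXY); clear -Xy Yy; lia.
have Xfar c' : stuck c' -> y \notin c' -> u \in c' -> X (next c' u) = X u - 1.
  move=> sc' yc' uc'; have far := stuck_next_far sc' yc' kXY uc' yu.
  have [n1 n2 n3 n4 _] := king_near kXY (stuck_next_edge sc' uc').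
  by case: far; clear -n1 n2 n3 n4 Xy Yy; lia.
have gc : graph_cycle e c by case/andP: sc.
have sc' : stuck (rev c) by rewrite stuck_rev.
have no z : X z = X u -> Y z = Y u + 1 \/ Y z = Y u - 1 -> False.
  move=> Xz Yz.
  have zu : e z u by apply: (king_adjP kXY); clear -Xz Yz; lia.
  have zy : e y z by apply: (king_adjP kXY); clear -Xz Yz Xy Yy; lia.
  have [zc|zc] := boolP (z \in c).
    apply: (stuck_orthogonal sc yc (king_swap kXY) uc zc Xz) => //.
      by clear -Xy; lia.
    by rewrite e_sym.
  (* Here [z] is a second off-cycle vertex adjacent to [u]: both neighbours of [u] along [c] avoid
     it in the row opposite to [z], and with [Xfar] they coincide. *)
  have Yfar c' : stuck c' -> c' =i c -> Y (next c' u) = Y u + (Y u - Y z).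
    move=> sd cd; have [yd zd ud] : [/\ y \notin c', z \notin c' & u \in c'].
      by rewrite !cd.
    have far := stuck_next_far sd zd kXY ud zu.
    have [n1 n2 n3 n4 _] := king_near kXY (stuck_next_edge sd ud).
    have Xn := Xfar _ sd yd ud.
    by case: far; clear -n1 n2 n3 n4 Xz Yz Xn; lia.
  have := king_neq kXY (next_neq_prev gc uc).
  have Uc : uniq c by case/and3P: gc.
  rewrite -next_rev // !Xfar ?mem_rev // !Yfar // ?eqxx; first by case.
  by move=> x; rewrite mem_rev.
(* The successor of [u] and [y] lie on opposite sides of the column of [u], so a path avoiding [u]
   meets this column elsewhere; convexity then gives a vertex excluded by [no]. *)
have [v vu /eqP] : exists2 v, v != u & X v - X u = 0.
  have nu := stuck_next_edge sc uc.
  apply: (@crossing _ u (next c u) y).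
  - by move=> v w /(king_near kXY)[_ + _ _ _]; clear; lia.
  - by apply/eqP=> Eu; have := Xfar _ sc yc uc; rewrite Eu; clear; lia.
  - by apply: contraNneq yc => ->.
  - by rewrite Xfar //; clear; lia.
  - by rewrite Xy; clear; lia.
rewrite subr_eq0 => /eqP Xv.
have [Xvu|Yv] := king_neq kXY vu; first by rewrite Xv eqxx in Xvu.
have [lt|lt] : Y u + 1 <= Y v \/ Y v <= Y u - 1 by clear -Yv; lia.
- have [| ||z Yz Xz] := king_col kXY (a := u) (b := v) (k := Y u + 1) => //.
    by clear; lia.
  by apply: (no z) => //; left.
- have [| ||z Yz Xz] := king_col kXY (a := v) (b := u) (k := Y u - 1) => //.
    by clear; lia.
  by apply: (no z); [rewrite Xz|right].
Qed.

Lemma stuck_row (c : seq T) (y : T) (X Y : T -> int) (u : T) :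
  stuck c -> y \notin c -> king_coordinates X Y -> u \in c ->
  Y y = Y u -> e y u -> False.
Proof.
move=> sc yc kXY uc Yy /(king_near kXY)[y1 y2 _ _ y3].
have [Xy|Xy] : X y = X u + 1 \/ - X y = - X u + 1.
- by clear -y1 y2 y3 Yy; lia.
- exact: (stuck_row_base sc yc kXY uc).
- exact: (stuck_row_base sc yc (king_opp kXY) uc).
Qed.

Lemma stuck_diagonal_base (c : seq T) (y : T) (X Y : T -> int) (u : T) :
  stuck c -> y \notin c -> king_coordinates X Y -> u \in c ->
  Y y = Y u + 1 -> X y = X u + 1 -> False.
Proof.
move=> sc yc kXY uc Yy Xy.
have no1 z : X z = X u + 1 -> Y z = Y u -> False.
  move=> Xz Yz; have [zc|zc] := boolP (z \in c).
    apply: (stuck_row sc yc (king_swap kXY) zc); first by rewrite Xz.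
    by apply: (king_adjP kXY); clear -Xy Yy Xz Yz; lia.
  apply: (stuck_row sc zc kXY uc) => //.
  by apply: (king_adjP kXY); clear -Xz Yz; lia.
have no2 z : X z = X u -> Y z = Y u + 1 -> False.
  move=> Xz Yz; have [zc|zc] := boolP (z \in c).
    apply: (stuck_row sc yc kXY zc); first by rewrite Yz.
    by apply: (king_adjP kXY); clear -Xy Yy Xz Yz; lia.
  apply: (stuck_row sc zc (king_swap kXY) uc) => //.
  by apply: (king_adjP kXY); clear -Xz Yz; lia.
have nu := king_near kXY (stuck_next_edge sc uc).
have ny := king_neq kXY (a := y) (b := next c u).
(* The zero set of this minimum is the boundary of the quadrant with corner [u] that contains [y].
   Apart from [u] it consists of two half-lines, which [no1], [no2] and convexity keep free of
   vertices. *)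
have [v vu v0] : exists2 v, v != u & Num.min (X v - X u) (Y v - Y u) = 0.
  apply: (@crossing _ u (next c u) y).
  - by move=> v w /(king_near kXY)[? ? ? ? _]; lia.
  - by apply/eqP=> Eu; move: nu; rewrite Eu; clear; case; lia.
  - by apply: contraNneq yc => ->.
  - have yn : y != next c u by apply: contraNneq yc => ->; rewrite mem_next.
    by case: nu; move: (ny yn); clear -Xy Yy; lia.
  - by rewrite Xy Yy; clear; lia.
have := king_neq kXY vu => vu'.
have [[Xv Yv]|[Yv Xv]] : (X v = X u /\ Y u + 1 <= Y v) \/ (Y v = Y u /\ X u + 1 <= X v).
- by clear -v0 vu'; lia.
- have [| ||z Yz Xz] := king_col kXY (a := u) (b := v) (k := Y u + 1) => //.
    by clear; lia.
  exact: (no2 z).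
- have [| ||z Xz Yz] := king_row kXY (a := u) (b := v) (k := X u + 1) => //.
    by clear; lia.
  exact: (no1 z).
Qed.

Lemma stuck_hamiltonian (c : seq T) (X Y : T -> int) :
  king_coordinates X Y -> stuck c -> hamiltonian c.
Proof.
move=> kXY sc x; apply/negPn/negP=> xc.
have [u [y [uc yc yu]]] : exists u y, [/\ u \in c, y \notin c & e y u].
  have /and3P[sz _ Uc] : graph_cycle e c by case/andP: sc.
  have [a ac] : exists a, a \in c.
    by case: c sz {sc xc Uc} => // a s _; exists a; rewrite mem_head.
  (* [connectedD1] needs a vertex to avoid; the successor of [a] serves, as it differs from [a] and
     from [x]. *)
  have xa : x != next c a by apply: contraNneq xc => ->; rewrite mem_next.
  have aN : a != next c a.
    apply/eqP=> Ea; have := king_near kXY (stuck_next_edge sc ac).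
    by rewrite -Ea; clear; case; lia.
  have [p [pp lp _]] := connectedD1 aN xa.
  elim: p a ac {xa aN} pp lp => [|w p IHp] a ac /=.
    by move=> _ Ea; rewrite -Ea ac in xc.
  move=> /andP[aw pw] lp; have [wc|wc] := boolP (w \in c).
    exact: (IHp w).
  by exists a, w; rewrite e_sym.
have [y1 y2 y3 y4 _] := king_near kXY yu.
have [Yy|Yy] := eqVneq (Y y) (Y u); first exact: (stuck_row sc yc kXY uc).
have [Xy|Xy] := eqVneq (X y) (X u).
  exact: (stuck_row sc yc (king_swap kXY) uc).
(* The four diagonal directions reduce to one by reflections and a quarter turn. *)
have [Xd|Xd] : X y = X u + 1 \/ - X y = - X u + 1 by clear -Xy y1 y2; lia.
  have [Yd|Yd] : Y y = Y u + 1 \/ - Y y = - Y u + 1 by clear -Yy y3 y4; lia.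
    exact: (stuck_diagonal_base sc yc kXY uc).
  exact: (stuck_diagonal_base sc yc (king_opp (king_swap kXY)) uc).
have kX' := king_opp kXY.
have [Yd|Yd] : Y y = Y u + 1 \/ - Y y = - Y u + 1 by clear -Yy y3 y4; lia.
  exact: (stuck_diagonal_base sc yc kX' uc).
exact: (stuck_diagonal_base sc yc (king_opp (king_swap kX')) uc).
Qed.

End CycleExtension.

(** * Consequences of 2-connectivity *)

Local Open Scope ring_scope.

(** Of two internally disjoint paths from [a] to [b], at most one passes through [u]. *)
Lemma two_connectedD1 (T : finType) (e : rel T) : two_connected e ->
  forall u a b, a != u -> b != u ->
  exists p, [/\ path e a p, last a p = b & u \notin a :: p].
Proof.
move=> [_ paths] u a b au bu.
have [<-|ab] := eqVneq a b; first by exists [::]; rewrite mem_seq1 eq_sym.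
have [s1 [s2 [/andP[p1 _] /andP[p2 _] _ dis]]] := paths a b ab.
have avoid s : path e a (rcons s b) -> u \notin s ->
    exists p, [/\ path e a p, last a p = b & u \notin a :: p].
  move=> ps us; exists (rcons s b).
  by rewrite last_rcons inE mem_rcons inE !negb_or eq_sym au eq_sym bu.
have [us1|us1] := boolP (u \in s1); last exact: avoid p1 us1.
by apply: avoid p2 _; rewrite (disjointFr dis).
Qed.

(** Go along one of two internally disjoint paths and return along the other. *)
Lemma two_connected_cycle (T : finType) (e : rel T) : symmetric e ->
  two_connected e -> exists c : seq T, graph_cycle e c.
Proof.
move=> e_sym [T_gt2 paths].
have [u [v uv]] : exists u v : T, u != v.
  have /card_gt1P[u [v [_ _ uv]]] : (1 < #|T|)%N by apply: ltnW.
  by exists u, v.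
have [s1 [s2 [/andP[p1 us1] /andP[p2 us2] s12 dis]]] := paths u v uv.
exists (u :: s1 ++ v :: rev s2); apply/and3P; split.
(* As [s1 != s2], they are not both empty, which provides a third vertex. *)
- rewrite /= size_cat /= size_rev.
  by case: s1 s12 {p1 us1 dis} => [|? ?]; case: s2 {p2 us2} => [|? ?] //= _;
    rewrite ?addnS.
- have p2r : path e v (rcons (rev s2) u).
    have := rev_path e u (rcons s2 v); rewrite last_rcons belast_rcons rev_cons.
    by move=> ->; rewrite (eq_path (e' := e)) // => x z; rewrite e_sym.
  by move: p1; rewrite /= rcons_cat /= cat_path rcons_path /= => /andP[-> ->].
- move: us1 us2; rewrite /= !mem_rcons !rcons_uniq !inE !negb_or.
  move=> /and3P[/andP[_ u1] v1 uq1] /and3P[/andP[_ u2] v2 uq2].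
  rewrite mem_cat inE mem_rev !negb_or u1 uv u2 cat_uniq /= mem_rev v2.
  rewrite rev_uniq uq1 uq2 negb_or v1 !andbT /=.
  apply/hasPn=> x; rewrite mem_rev => xs2.
  by rewrite /= (disjointFl dis).
Qed.

(** * Coordinates on a linear-convex supergrid graph *)

Lemma supergrid_rel_sym (G : {fset point}) : symmetric (supergrid_rel G).
Proof.
move=> u v; rewrite /supergrid_rel /supergrid_adj /= eq_sym.
by rewrite (distrC (val u).1) (distrC (val u).2).
Qed.

(** If [p] has index [k0] on the segment starting at [a], the far point has index [k0 + j], at most
    [n], and [k0 + i] lies in between. *)
Lemma linear_convex_between (G : {fset point}) (p q : point) (i j : nat) :
  linear_convex G -> supergrid_adj p q -> p \in G -> p + (q - p) *+ j \in G ->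
  (i <= j)%N -> p + (q - p) *+ i \in G.
Proof.
move=> cG pq pG pjG ij.
have line k : on_line p q (p + (q - p) *+ k).
  rewrite /on_line pairMnE /= ![p.1 + _]addrC ![p.2 + _]addrC !addrK.
  by rewrite mulrnAl mulrnAl mulrC.
have [none|[a [n Gn]]] := cG p q pq; first by have := none _ pjG; rewrite line.
have [k0 k0n Ep] : exists2 k, (k <= n)%N & p = a + (q - p) *+ k.
  by apply/Gn; rewrite pG; have := line 0; rewrite mulr0n addr0.
have [k1 k1n Ej] : exists2 k, (k <= n)%N & p + (q - p) *+ j = a + (q - p) *+ k.
  by apply/Gn; rewrite pjG line.
have /andP[] // : (p + (q - p) *+ i \in G) && on_line p q (p + (q - p) *+ i).
apply/Gn; exists (k0 + i)%N; last by rewrite {1}Ep -addrA -mulrnDr.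
apply: leq_trans k1n; suff <- : (k0 + j)%N = k1 by rewrite leq_add2l.
move: Ej; rewrite {1}Ep -addrA -mulrnDr => /addrI.
case/and3P: pq => pq _ _; rewrite !pairMnE => -[E1 E2].
(* A nonzero coordinate of [q - p] makes the index of a point unique. *)
have [d1|d1] := eqVneq (q.1 - p.1) 0; last exact: (mulrIn d1).
have [d2|d2] := eqVneq (q.2 - p.2) 0; last exact: (mulrIn d2).
case/eqP: pq; apply/eqP; rewrite eq_sym -subr_eq0.
by apply/eqP; rewrite [LHS]surjective_pairing /= d1 d2.
Qed.

Lemma supergrid_king (G : {fset point}) : linear_convex G ->
  king_coordinates (supergrid_rel G) (fun u => (val u).1) (fun u => (val u).2).
Proof.
move=> cG; split.
- move=> a b; rewrite /supergrid_rel /supergrid_adj /= (inj_eq val_inj).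
  by congr (_ && _); apply/idP/idP; lia.
- by move=> [[a1 a2] aG] [[b1 b2] bG] /= E1 E2; apply: val_inj; rewrite /= E1 E2.
- move=> [[x y] aG] [[x' y'] bG] k /= Ey lek kle; subst y'.
  have step (i : nat) : (x, y) + ((x + 1, y) - (x, y)) *+ i = (x + i%:Z, y) :> point.
    by rewrite pairMnE /=; congr (_, _) => /=; lia.
  have kG : (x, y) + ((x + 1, y) - (x, y)) *+ `|k - x|%N \in G.
    apply: (@linear_convex_between _ _ _ _ `|x' - x|%N cG _ aG).
    + by rewrite /supergrid_adj /= xpair_eqE; clear; lia.
    + by rewrite step (_ : x + _ = x') //; clear -lek kle; lia.
    + by clear -lek kle; lia.
  rewrite step (_ : x + _ = k) in kG; last by clear -lek; lia.
  by exists [` kG]%fset.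
- move=> [[x y] aG] [[x' y'] bG] k /= Ex lek kle; subst x'.
  have step (i : nat) : (x, y) + ((x, y + 1) - (x, y)) *+ i = (x, y + i%:Z) :> point.
    by rewrite pairMnE /=; congr (_, _) => /=; lia.
  have kG : (x, y) + ((x, y + 1) - (x, y)) *+ `|k - y|%N \in G.
    apply: (@linear_convex_between _ _ _ _ `|y' - y|%N cG _ aG).
    + by rewrite /supergrid_adj /= xpair_eqE; clear; lia.
    + by rewrite step (_ : y + _ = y') //; clear -lek kle; lia.
    + by clear -lek kle; lia.
  rewrite step (_ : y + _ = k) in kG; last by clear -lek; lia.
  by exists [` kG]%fset.
Qed.

Theorem theorem2 (G : {fset point}) :
  two_connected (supergrid_rel G) -> linear_convex G ->
  cycle_extendable (supergrid_rel G).
Proof.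
move=> conn cG; have e_sym := @supergrid_rel_sym G.
split; first exact: two_connected_cycle.
move=> c gc nham; have [|ext] := boolP (extensible (supergrid_rel G) c).
  move=> /extensibleP[c' [gc' sub sz]]; exists c'; split=> //.
  (* Cycles are duplicate-free, so their cardinalities are their lengths. *)
  have /and3P[_ _ /card_uniqP->] := gc; have /and3P[_ _ /card_uniqP->] := gc'.
  exact: sz.
case: nham; apply: (stuck_hamiltonian e_sym (two_connectedD1 conn)) (supergrid_king cG) _.
by rewrite /stuck gc.
Qed.
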